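(* The class $\mathcal S$ of all SMB algebras (of arbitrary cardinality) is a variety, i.e. it is closed under homomorphic images, subalgebras and direct products.
   Context: An algebra $\mathbf A=(A;\wedge,d)$ with a binary operation $\wedge$ and a ternary operation $d$ is idempotent if $x\wedge x=x$ and $d(x,x,x)=x$ for all $x\in A$. For a congruence ${\sim}$ of $\mathbf A$, $\mathbf A$ is an SMB algebra over ${\sim}$ if $\mathbf A$ is idempotent and: (i) $(A/{\sim};\wedge^{\mathbf A/{\sim}})$ is a semilattice; (ii) on each ${\sim}$-class $D$ (a subuniverse, by idempotence), $\wedge$ restricted to $D$ is the second projection ($x\wedge y=y$ for $x,y\in D$) and $d$ restricted to $D$ is a Mal'cev operation ($d(x,y,y)=x=d(y,y,x)$ for $x,y\in D$). $\mathbf A$ is an SMB algebra if it is an SMB algebra over some congruence of $\mathbf A$. *)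

(* Defs.v *)
From Stdlib Require Import Relations.

Set Implicit Arguments.
Unset Strict Implicit.

(* Carriers may be empty: the empty algebra is vacuously an SMB algebra. *)
Record algebra := Algebra {
  carrier :> Type;
  meet : carrier -> carrier -> carrier;
  dop : carrier -> carrier -> carrier -> carrier
}.

Arguments meet {a} _ _.
Arguments dop {a} _ _ _.

Definition idempotent (A : algebra) : Prop :=
  (forall x : A, meet x x = x) /\ (forall x : A, dop x x x = x).

Record congruence (A : algebra) := Congruence {
  crel :> A -> A -> Prop;
  crel_equiv : equivalence A crel;
  crel_meet : forall x x' y y' : A,
    crel x x' -> crel y y' -> crel (meet x y) (meet x' y');
  crel_dop : forall x x' y y' z z' : A,
    crel x x' -> crel y y' -> crel z z' -> crel (dop x y z) (dop x' y' z')
}.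

Section Quotient.
Variables (A : algebra) (r : congruence A).

Definition is_class (D : A -> Prop) : Prop := exists a, forall x, D x <-> r a x.

Definition quotient_carrier : Type := {D : A -> Prop | is_class D}.

Definition quotient_meet_set (D E : A -> Prop) (z : A) : Prop :=
  exists x y, D x /\ E y /\ r (meet x y) z.

Definition quotient_dop_set (D E F : A -> Prop) (w : A) : Prop :=
  exists x y z, D x /\ E y /\ F z /\ r (dop x y z) w.

Lemma quotient_meet_class (D E : A -> Prop) :
  is_class D -> is_class E -> is_class (quotient_meet_set D E).
Proof.
intros [a Ha] [b Hb]; exists (meet a b); intro z; split.
- intros (x & y & Hx & Hy & Hz).
  apply (equiv_trans _ _ (crel_equiv r)) with (meet x y); [|exact Hz].
  apply crel_meet; [apply Ha | apply Hb]; assumption.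
- intro Hz; exists a, b; repeat split; [apply Ha | apply Hb | exact Hz];
  apply (equiv_refl _ _ (crel_equiv r)).
Qed.

Lemma quotient_dop_class (D E F : A -> Prop) :
  is_class D -> is_class E -> is_class F -> is_class (quotient_dop_set D E F).
Proof.
intros [a Ha] [b Hb] [c Hc]; exists (dop a b c); intro w; split.
- intros (x & y & z & Hx & Hy & Hz & Hw).
  apply (equiv_trans _ _ (crel_equiv r)) with (dop x y z); [|exact Hw].
  apply crel_dop; [apply Ha | apply Hb | apply Hc]; assumption.
- intro Hw; exists a, b, c; repeat split;
  [apply Ha | apply Hb | apply Hc | exact Hw];
  apply (equiv_refl _ _ (crel_equiv r)).
Qed.

Definition quotient : algebra :=
  @Algebra quotient_carrier
    (fun D E => exist is_class (quotient_meet_set (proj1_sig D) (proj1_sig E))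
       (quotient_meet_class (proj2_sig D) (proj2_sig E)))
    (fun D E F => exist is_class
       (quotient_dop_set (proj1_sig D) (proj1_sig E) (proj1_sig F))
       (quotient_dop_class (proj2_sig D) (proj2_sig E) (proj2_sig F))).

End Quotient.

Definition semilattice (T : Type) (op : T -> T -> T) : Prop :=
  (forall x y z, op x (op y z) = op (op x y) z) /\
  (forall x y, op x y = op y x) /\
  (forall x, op x x = x).

Definition SMB_over (A : algebra) (r : congruence A) : Prop :=
  idempotent A /\
  semilattice (@meet (quotient r)) /\
  (forall D : A -> Prop, is_class r D ->
     (forall x y, D x -> D y -> meet x y = y) /\
     (forall x y, D x -> D y -> dop x y y = x /\ dop y y x = x)).

Definition SMB (A : algebra) : Prop := exists r : congruence A, SMB_over r.

Definition homomorphism (A B : algebra) (f : A -> B) : Prop :=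
  (forall x y, f (meet x y) = meet (f x) (f y)) /\
  (forall x y z, f (dop x y z) = dop (f x) (f y) (f z)).

Definition surjective (S T : Type) (f : S -> T) : Prop :=
  forall y, exists x, f x = y.

Record subuniverse (A : algebra) := Subuniverse {
  in_sub :> A -> Prop;
  sub_meet : forall x y, in_sub x -> in_sub y -> in_sub (meet x y);
  sub_dop : forall x y z,
    in_sub x -> in_sub y -> in_sub z -> in_sub (dop x y z)
}.

Definition subalgebra (A : algebra) (S : subuniverse A) : algebra :=
  @Algebra {x : A | S x}
    (fun x y => exist S (meet (proj1_sig x) (proj1_sig y))
       (sub_meet (proj2_sig x) (proj2_sig y)))
    (fun x y z => exist S (dop (proj1_sig x) (proj1_sig y) (proj1_sig z))
       (sub_dop (proj2_sig x) (proj2_sig y) (proj2_sig z))).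

Definition product (I : Type) (A : I -> algebra) : algebra :=
  @Algebra (forall i, A i)
    (fun x y i => meet (x i) (y i))
    (fun x y z i => dop (x i) (y i) (z i)).

Definition closed_under_images (K : algebra -> Prop) : Prop :=
  forall (A B : algebra) (f : A -> B),
    homomorphism f -> surjective f -> K A -> K B.

Definition closed_under_subalgebras (K : algebra -> Prop) : Prop :=
  forall (A : algebra) (S : subuniverse A), K A -> K (subalgebra S).

Definition closed_under_products (K : algebra -> Prop) : Prop :=
  forall (I : Type) (A : I -> algebra), (forall i, K (A i)) -> K (product A).

Definition variety (K : algebra -> Prop) : Prop :=
  closed_under_images K /\ closed_under_subalgebras K /\ closed_under_products K.

(* Main.v *)
(** In an SMB algebra the congruence is determined by the meet: [x ~ y] holds iff
    [x /\ y = y] and [y /\ x = x].  Hence being an SMB algebra is a condition on this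
    relation alone, and all of its clauses pass to subalgebras and products.
    For a surjective homomorphism [f], a related pair [(x, y)] of the image lifts
    to a related pair: if [f a = x] and [f b = y], then [b /\ a] and [a /\ b] are
    related, since the quotient semilattice is commutative, and they are mapped to
    [y /\ x = x] and [x /\ y = y]. *)
From Stdlib Require Import Relations FunctionalExtensionality.
From Stdlib Require Import PropExtensionality ProofIrrelevance.
Require Import Defs.

Set Implicit Arguments.
Unset Strict Implicit.

Lemma sig_ext (T : Type) (P : T -> Prop) (u v : {x : T | P x}) :
  proj1_sig u = proj1_sig v -> u = v.
Proof. apply eq_sig_hprop; intros; apply proof_irrelevance. Qed.

Section QuotientClasses.
Variables (A : algebra) (r : congruence A).

Lemma crel_refl x : r x x.
Proof. apply (equiv_refl _ _ (crel_equiv r)). Qed.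

Lemma crel_sym x y : r x y -> r y x.
Proof. apply (equiv_sym _ _ (crel_equiv r)). Qed.

Lemma crel_trans y x z : r x y -> r y z -> r x z.
Proof. apply (equiv_trans _ _ (crel_equiv r)). Qed.

Lemma is_class_crel x : is_class r (r x).
Proof. exists x; intro; reflexivity. Qed.

Definition class_of (x : A) : quotient r := exist (is_class r) (r x) (is_class_crel x).

(** Elements of the quotient are predicates with a proof, so this rests on functional and
    propositional extensionality and on proof irrelevance. *)
Lemma class_of_eq x y : class_of x = class_of y <-> r x y.
Proof.
split.
- intro E; change (proj1_sig (class_of x) y); rewrite E; apply crel_refl.
- intro xy; apply sig_ext, functional_extensionality; intro z.
  apply propositional_extensionality; split; apply crel_trans; auto using crel_sym.
Qed.

Lemma class_of_surjective : surjective class_of.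
Proof.
intros [D [a Da]]; exists a; apply sig_ext, functional_extensionality; intro z.
symmetry; apply propositional_extensionality, Da.
Qed.

Lemma class_of_meet x y : meet (class_of x) (class_of y) = class_of (meet x y).
Proof.
apply sig_ext, functional_extensionality; intro z.
apply propositional_extensionality; split.
- intros (x' & y' & xx' & yy' & Hz).
  exact (crel_trans (crel_meet xx' yy') Hz).
- intro Hz; exists x, y; repeat split; auto; apply crel_refl.
Qed.

(** Every element of the quotient is a [class_of], which commutes with [meet]; equations between
    classes thus become instances of [r]. *)
Lemma semilattice_quotient :
  semilattice (@meet (quotient r)) <->
  (forall x y z, r (meet x (meet y z)) (meet (meet x y) z)) /\
  (forall x y, r (meet x y) (meet y x)) /\
  (forall x, r (meet x x) x).
Proof.
split; intros (assoc & comm & idem).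
- repeat split; intros; apply class_of_eq; rewrite <- !class_of_meet; auto.
- repeat split.
  + intros X Y Z; destruct (class_of_surjective X) as [x <-],
      (class_of_surjective Y) as [y <-], (class_of_surjective Z) as [z <-].
    rewrite !class_of_meet; apply class_of_eq, assoc.
  + intros X Y; destruct (class_of_surjective X) as [x <-],
      (class_of_surjective Y) as [y <-].
    rewrite !class_of_meet; apply class_of_eq, comm.
  + intros X; destruct (class_of_surjective X) as [x <-].
    rewrite class_of_meet; apply class_of_eq, idem.
Qed.

End QuotientClasses.

Definition sim (A : algebra) (x y : A) : Prop := meet x y = y /\ meet y x = x.

Lemma sim_sym (A : algebra) (x y : A) : sim x y -> sim y x.
Proof. intros []; split; assumption. Qed.

(** Reflexivity of [sim] is contained in idempotence; symmetry and the second projection law on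
    classes are built into the form of [sim]. *)
Record sim_SMB (A : algebra) : Prop := SimSMB {
  sim_idem : idempotent A;
  sim_trans : forall x y z : A, sim x y -> sim y z -> sim x z;
  sim_meet : forall x x' y y' : A,
    sim x x' -> sim y y' -> sim (meet x y) (meet x' y');
  sim_dop : forall x x' y y' z z' : A,
    sim x x' -> sim y y' -> sim z z' -> sim (dop x y z) (dop x' y' z');
  sim_meetA : forall x y z : A, sim (meet x (meet y z)) (meet (meet x y) z);
  sim_meetC : forall x y : A, sim (meet x y) (meet y x);
  sim_malcev : forall x y : A, sim x y -> dop x y y = x /\ dop y y x = x
}.

Lemma sim_refl (A : algebra) : idempotent A -> forall x : A, sim x x.
Proof. intros [idem _] x; split; apply idem. Qed.

(** Elements related by [r] share a class, where [meet] is the second projection. Conversely,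
    [sim x y] turns the pair [x], [y] into [meet y x], [meet x y], related by commutativity of the
    quotient. *)
Lemma SMB_over_sim (A : algebra) (r : congruence A) :
  SMB_over r -> forall x y, r x y <-> sim x y.
Proof.
intros (_ & sl & cls) x y; apply semilattice_quotient in sl.
destruct sl as (_ & comm & _); split.
- intro xy; destruct (cls (r x) (is_class_crel r x)) as [proj _].
  split; apply proj; auto using crel_refl.
- intros [xy yx]; rewrite <- xy, <- yx at 1; apply comm.
Qed.

Lemma SMB_sim (A : algebra) : SMB A <-> sim_SMB A.
Proof.
split.
- intros [r smb]; pose proof (SMB_over_sim smb) as E.
  destruct smb as (idem & sl & cls); apply semilattice_quotient in sl.
  destruct sl as (assoc & comm & _).
  split; try intros *; rewrite <- ?E; auto.
  + apply crel_trans.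
  + apply crel_meet.
  + apply crel_dop.
  + intro xy; apply (cls (r x) (is_class_crel r x)); auto using crel_refl.
- intros [idem trans cmeet cdop assoc comm malcev].
  assert (eqv : equivalence A (@sim A)).
  { split; [exact (sim_refl idem) | exact trans | exact (@sim_sym A)]. }
  exists (Congruence eqv cmeet cdop); split; [exact idem | split].
  + apply semilattice_quotient; repeat split; try apply assoc; try apply comm;
      rewrite !(proj1 idem); reflexivity.
  + intros D [a Da].
    (* Two members of a class are related through its representative [a]. *)
    assert (DD : forall x y, D x -> D y -> sim x y).
    { intros x y Dx Dy; apply trans with a; [apply sim_sym|]; apply Da; assumption. }
    split; intros x y Dx Dy; [apply DD | apply malcev, DD]; assumption.
Qed.

Section Images.
Variables (A B : algebra) (f : A -> B).
Hypotheses (hom : homomorphism f) (surj : surjective f) (smbA : sim_SMB A).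

Lemma hom_sim a b : sim a b -> sim (f a) (f b).
Proof.
destruct hom as [fm _]; intros [ab ba]; split; rewrite <- fm; f_equal; assumption.
Qed.

Lemma sim_lift x y : sim x y -> exists a b, f a = x /\ f b = y /\ sim a b.
Proof.
destruct hom as [fm _]; intros [xy yx].
destruct (surj x) as [a <-], (surj y) as [b <-].
exists (meet b a), (meet a b); rewrite !fm; repeat split; auto; apply sim_meetC, smbA.
Qed.

Lemma sim_SMB_image : sim_SMB B.
Proof.
destruct hom as [fm fd].
destruct smbA as [[im id] trans cmeet cdop assoc comm malcev].
split.
- split; intro x; destruct (surj x) as [a <-];
    rewrite <- ?fm, <- ?fd, ?im, ?id; reflexivity.
(* Lifting the two pairs separately could give different preimages of [y], so one preimage of each
   element is fixed first. *)
- intros x y z [xy yx] [yz zy].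
  destruct (surj x) as [a <-], (surj y) as [b <-], (surj z) as [c <-].
  (* Here [x = (z /\ y) /\ x] and [z = (x /\ y) /\ z]. *)
  assert (Ea : f (meet (meet c b) a) = f a) by (rewrite !fm, zy; exact yx).
  assert (Ec : f (meet (meet a b) c) = f c) by (rewrite !fm, xy; exact yz).
  rewrite <- Ea, <- Ec; apply hom_sim.
  (* The chain is [(c b) a ~ a (c b) ~ a (b c) ~ (a b) c], with juxtaposition for [meet]. *)
  apply trans with (meet a (meet c b)); [apply comm|].
  apply trans with (meet a (meet b c)); [|apply assoc].
  apply cmeet; [apply sim_refl; split; assumption | apply comm].
- intros x x' y y' Hx Hy.
  destruct (sim_lift Hx) as (a & a' & <- & <- & Ha).
  destruct (sim_lift Hy) as (b & b' & <- & <- & Hb).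
  rewrite <- !fm; apply hom_sim; auto.
- intros x x' y y' z z' Hx Hy Hz.
  destruct (sim_lift Hx) as (a & a' & <- & <- & Ha).
  destruct (sim_lift Hy) as (b & b' & <- & <- & Hb).
  destruct (sim_lift Hz) as (c & c' & <- & <- & Hc).
  rewrite <- !fd; apply hom_sim; auto.
- intros x y z.
  destruct (surj x) as [a <-], (surj y) as [b <-], (surj z) as [c <-].
  rewrite <- !fm; apply hom_sim, assoc.
- intros x y; destruct (surj x) as [a <-], (surj y) as [b <-].
  rewrite <- !fm; apply hom_sim, comm.
(* The Mal'cev laws of [A] hold for related pairs, so the preimages must be related too. *)
- intros x y Hxy; destruct (sim_lift Hxy) as (a & b & <- & <- & Hab).
  rewrite <- !fd; destruct (malcev _ _ Hab) as [-> ->]; auto.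
Qed.

End Images.

(** [sim] consists of two equations, and equality in a subalgebra is that of the ambient algebra. *)
Lemma sim_subalgebra (A : algebra) (S : subuniverse A) (x y : subalgebra S) :
  sim x y <-> sim (proj1_sig x) (proj1_sig y).
Proof.
split; intros [xy yx]; split;
  [exact (f_equal (@proj1_sig _ _) xy) | exact (f_equal (@proj1_sig _ _) yx)
  | apply sig_ext, xy | apply sig_ext, yx].
Qed.

Lemma sim_SMB_subalgebra (A : algebra) (S : subuniverse A) :
  sim_SMB A -> sim_SMB (subalgebra S).
Proof.
intros [[im id] trans cmeet cdop assoc comm malcev].
split; try intros *; rewrite ?sim_subalgebra; simpl; eauto.
- split; intros; apply sig_ext; simpl; auto.
- intro xy; split; apply sig_ext; apply malcev, xy.
Qed.

Lemma sim_product (I : Type) (A : I -> algebra) (x y : product A) :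
  sim x y <-> forall i, sim (x i) (y i).
Proof.
split.
- intros [xy yx] i; split;
    [exact (f_equal (fun h => h i) xy) | exact (f_equal (fun h => h i) yx)].
- intro xy; split; apply functional_extensionality_dep; apply xy.
Qed.

(** All clauses are checked coordinatewise. As [sim] is canonical in each factor, no family of
    congruences has to be chosen over [I]. *)
Lemma sim_SMB_product (I : Type) (A : I -> algebra) :
  (forall i, sim_SMB (A i)) -> sim_SMB (product A).
Proof.
intro smb; split; try intros *; rewrite ?sim_product; simpl.
- split; intro x; apply functional_extensionality_dep; intro i;
    apply (sim_idem (smb i)).
- intros xy yz i; exact (sim_trans (smb i) (xy i) (yz i)).
- intros Hx Hy i; exact (sim_meet (smb i) (Hx i) (Hy i)).
- intros Hx Hy Hz i; exact (sim_dop (smb i) (Hx i) (Hy i) (Hz i)).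
- intro i; apply sim_meetA, smb.
- intro i; apply sim_meetC, smb.
- intro xy; split; apply functional_extensionality_dep; intro i;
    apply (sim_malcev (smb i) (xy i)).
Qed.

Theorem theorem4p3 : variety SMB.
Proof.
split; [|split].
- intros A B f hom surj; rewrite !SMB_sim; exact (sim_SMB_image hom surj).
- intros A S; rewrite !SMB_sim; apply sim_SMB_subalgebra.
- intros I A smb; apply SMB_sim, sim_SMB_product; intro i; apply SMB_sim, smb.
Qed.
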